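(* Let $N, d \in \mathbb{N}$, $\mathfrak{C}\in [0,\infty)$, let $a\in C(\mathbb{R},\mathbb{R})$ satisfy for all $x\in \mathbb{R}$ that $a(x)=\max\{x,0\}$, let $T\in (0,\infty)$, $(t_n)_{n\in\{0,1,\dots,N\}}\subseteq\mathbb{R}$ satisfy for all $n\in\{0,1,\dots,N\}$ that $t_n=\frac{nT}{N}$, let $\mathfrak{D}\in[1,\infty)$, $\varepsilon\in (0,1]$, $q\in(2,\infty)$ satisfy $$\mathfrak{D}=\big[\tfrac{720q}{(q-2)}\big]\big[\log_2(\varepsilon^{-1})+q+1\big]-504,$$ let $\Phi\in \mathbf{N}$ satisfy for all $x\in \mathbb{R}^d$ that $\mathcal{I}(\Phi)=\mathcal{O}(\Phi)=d$ and $\Vert (\mathcal{R}_a(\Phi))(x)\Vert\le \mathfrak{C}(1+\Vert x\Vert)$, let $Y= (Y^{x,y}_t)_{(t,x,y)\in [0,T]\times \mathbb{R}^d\times(\mathbb{R}^d)^N} \colon [0,T]\times \mathbb{R}^d\times (\mathbb{R}^d)^N \to \mathbb{R}^d$ be the function which satisfies for all $n\in\{0,1,\dots,N-1\}$, $t \in [t_{n},t_{n+1}]$, $x \in \mathbb{R}^d$, $y=(y_1,\dots, y_N)\in (\mathbb{R}^d)^N$ that $Y^{x,y}_0=x$ and $$Y^{x,y}_t = Y^{x,y}_{t_n}+ \left(\tfrac{tN}{T}-n\right)\left[\tfrac{T}{N}(\mathcal{R}_a(\Phi)) \big( Y^{x,y}_{t_n} \big) + y_{n+1}\right],$$ and let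 $g_n\colon \mathbb{R}^d\times (\mathbb{R}^d)^N\to [0,\infty)$, $n\in\{0,1,\dots,N\}$, be the functions which satisfy for all $n\in\{0,1,\dots,N\}$, $x \in \mathbb{R}^d$, $y=(y_1,\dots, y_N)\in (\mathbb{R}^d)^N$ that $$g_{n}(x,y)=\Big(\Vert x\Vert + \mathfrak{C}t_n+\max_{m\in\{0,1,\dots,n\}}\Big\Vert \sum_{k=1}^{m} y_{k}\Big\Vert\Big)\exp(\mathfrak{C} t_n).$$ Then there exist $\Psi_{y}\in \mathbf{N}$, $y\in (\mathbb{R}^d)^N$, such that (i) for all $y\in (\mathbb{R}^d)^N$: $\mathcal{R}_a (\Psi_{y})\in C(\mathbb{R}^{d+1},\mathbb{R}^d)$; (ii) for all $n\in\{0,1,\dots,N-1\}$, $t \in [t_{n},t_{n+1}]$, $x\in\mathbb{R}^d$, $y\in (\mathbb{R}^d)^N$: $\Vert Y^{x,y}_t -(\mathcal{R}_a (\Psi_{y}))(t,x)\Vert\le\varepsilon \big(2\sqrt{d}+(g_{n}(x,y))^q+(g_{n+1}(x,y))^q\big)$; (iii) for all $n\in\{0,1,\dots,N-1\}$, $t \in [t_{n},t_{n+1}]$, $x\in\mathbb{R}^d$, $y\in (\mathbb{R}^d)^N$: $\Vert (\mathcal{R}_a (\Psi_{y}))(t,x)\Vert\le 6\sqrt{d}+2\big((g_{n}(x,y))^2+(g_{n+1}(x,y))^2\big)$; (iv) for all $y\in (\mathbb{R}^d)^N$: $$\mathcal{P}(\Psi_{y})\le\tfrac{9}{2}\, N^6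 d^{16} \Big[ 2 \mathcal{H}(\Phi)+\mathfrak{D}+\big(30+6\mathcal{H}(\Phi)+ [4+\mathcal{P}(\Phi)]^{2}\big)^{2}\Big]^{2};$$ (v) for all $t\in [0,T]$, $x\in\mathbb{R}^d$: $\big[(\mathbb{R}^d)^N\ni y\mapsto (\mathcal{R}_a (\Psi_{y}))(t,x)\in\mathbb{R}^d\big]\in C((\mathbb{R}^d)^N,\mathbb{R}^d)$; and (vi) for all $n\in\{0,1,\dots, N\}$, $t\in [0,t_n]$, $x\in\mathbb{R}^d$, $y=(y_1,\dots, y_N)$, $z=(z_1,\dots, z_N)\in (\mathbb{R}^d)^N$ with $\forall\, k\in \mathbb{N}\cap [0,n]\colon y_k=z_k$: $(\mathcal{R}_a (\Psi_{y}))(t,x)=(\mathcal{R}_a (\Psi_{z}))(t,x)$.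
   Context: $\mathbb{N}=\{1,2,3,\dots\}$, $\mathbb{N}_0=\mathbb{N}\cup\{0\}$, $\Vert\cdot\Vert$ is the Euclidean norm, empty sums are $0$. Artificial neural networks (ANNs): $\mathbf{N}=\cup_{L \in \mathbb{N}}\cup_{(l_0,\ldots, l_L) \in \mathbb{N}^{L+1}}\big(\times_{k = 1}^L (\mathbb{R}^{l_k \times l_{k-1}} \times \mathbb{R}^{l_k})\big)$. For $\Phi\in \times_{k = 1}^L (\mathbb{R}^{l_k \times l_{k-1}} \times \mathbb{R}^{l_k})$: number of parameters $\mathcal{P}(\Phi)=\sum_{k=1}^L l_k(l_{k-1}+1)$, length $\mathcal{L}(\Phi)=L$, input dimension $\mathcal{I}(\Phi)=l_0$, output dimension $\mathcal{O}(\Phi)=l_L$, number of hidden layers $\mathcal{H}(\Phi)=L-1$. Realization: for $a\in C(\mathbb{R},\mathbb{R})$, $L,l_0,l_1,\dots,l_L\in\mathbb{N}$, and $\Phi=((W_1,B_1),\dots,(W_L,B_L))\in \times_{k = 1}^L (\mathbb{R}^{l_k \times l_{k-1}} \times \mathbb{R}^{l_k})$, the function $\mathcal{R}_a(\Phi)\in C(\mathbb{R}^{l_0},\mathbb{R}^{l_L})$ is given by $(\mathcal{R}_a(\Phi))(x_0)=W_Lx_{L-1}+B_L$, where $x_k=\mathfrak{M}_{a,l_k}(W_kx_{k-1}+B_k)$ for $k\in\mathbb{N}\cap(0,L)$ and $\mathfrak{M}_{a,m}(x_1,\dots,x_m)=(a(x_1),\dots,a(x_m))$. *)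

(* Defs.v *)
From mathcomp Require Import all_boot all_order all_algebra.
From mathcomp Require Import all_classical all_reals all_analysis.

Set Implicit Arguments.
Unset Strict Implicit.
Unset Printing Implicit Defensive.

Import Order.TTheory GRing.Theory Num.Theory.
Import numFieldNormedType.Exports.

Local Open Scope ring_scope.

(* R^n is 'cV[R]_n. The norm which that type carries
   in the library is the sup norm (its topology is the usual one), so the
   Euclidean norm is introduced separately. *)
Definition enorm (R : rcfType) (n : nat) (x : 'cV[R]_n) : R :=
  Num.sqrt (\sum_(i < n) x i ord0 ^+ 2).

Definition log2 (R : realType) (x : R) : R := ln x / ln 2.

(* ann R m n is the set of ANNs ((W_1, B_1), ..., (W_L, B_L)), L >= 1, with
   input dimension m and output dimension n; the union of these sets over m and
   n is the set of all ANNs. The first pair is (W_1, B_1). The side conditions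
   make every layer dimension l_0, ..., l_L positive. *)
Inductive ann (R : Type) : nat -> nat -> Type :=
| AnnLast (m n : nat) of (0 < m)%N & (0 < n)%N & 'M[R]_(n, m) & 'cV[R]_n :
    ann R m n
| AnnCons (m k n : nat) of (0 < m)%N & 'M[R]_(k, m) & 'cV[R]_k & ann R k n :
    ann R m n.

Fixpoint ann_length (R : Type) (m n : nat) (Phi : ann R m n) : nat :=
  match Phi with
  | AnnLast _ _ _ _ _ _ => 1
  | AnnCons _ _ _ _ _ _ Phi' => (ann_length Phi').+1
  end.

Definition ann_hidden (R : Type) (m n : nat) (Phi : ann R m n) : nat :=
  (ann_length Phi).-1.

Fixpoint ann_params (R : Type) (m n : nat) (Phi : ann R m n) : nat :=
  match Phi with
  | AnnLast m n _ _ _ _ => n * (m + 1)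
  | AnnCons m k _ _ _ _ Phi' => k * (m + 1) + ann_params Phi'
  end%N.

Fixpoint ann_realize (R : pzRingType) (a : R -> R) (m n : nat)
    (Phi : ann R m n) : 'cV[R]_m -> 'cV[R]_n :=
  match Phi with
  | AnnLast _ _ _ _ W B => fun x => W *m x + B
  | AnnCons _ _ _ _ W B Phi' =>
      fun x => ann_realize a Phi' (map_mx a (W *m x + B))
  end.

Definition time_space (R : Type) (d : nat) (t : R) (x : 'cV[R]_d) :
    'cV[R]_(1 + d) :=
  col_mx (const_mx t) x.

(* An element y = (y_1, ..., y_N) of (R^d)^N is a matrix 'M[R]_(d, N), and y_k
   is its column of index k - 1. *)
Definition psum (R : nmodType) (d N : nat) (y : 'M[R]_(d, N)) (m : nat) :
    'cV[R]_d :=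
  \sum_(k < N | (k < m)%N) col k y.

(* max_(0 <= m <= n) || y_1 + ... + y_m ||; the default value 0 of the maximum
   is the term m = 0. *)
Definition max_psum (R : rcfType) (d N : nat) (y : 'M[R]_(d, N)) (n : nat) :
    R :=
  \big[Num.max/0]_(m < n.+1) enorm (psum y m).

(* Main.v *)
(** The function Y is the piecewise linear interpolation, on the grid t_n, of
    the Euler iterates Y_n, so that Y_t = sum_n h_n(t) Y_n with hat functions
    h_n. The ANN realizes (t, x) |-> sum_n M(h_n(t), Y_n), where M is applied to
    each coordinate and is a ReLU approximation of the product on [0, 1] x R. To
    build M(s, v), clip v to [-2^k, 2^k] with 2^k >= 1 / eps and compute the
    product of s and v / 2^k by k iterations of the tent map, with a network of
    depth k + 2 and constant width. The error is at most eps max(1, v^2), M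
    grows at most linearly in v, and M(0, v) = 0. The discrete Gronwall
    inequality gives |Y_n| <= g_n. The parameters are counted from the depth
    N H + k + 4 and the largest layer width. *)

Require Import Defs.
From mathcomp Require Import all_boot all_order all_algebra.
From mathcomp Require Import all_classical all_reals all_analysis.
From mathcomp Require Import ring lra zify.

Import Order.TTheory GRing.Theory Num.Theory.
Import numFieldNormedType.Exports.

Local Open Scope ring_scope.

Set Implicit Arguments.
Unset Strict Implicit.
Unset Printing Implicit Defensive.

(** * Closure properties of ReLU networks *)

Fixpoint ann_width (R : Type) (m n : nat) (Phi : ann R m n) : nat :=
  match Phi with
  | AnnLast m n _ _ _ _ => maxn m n
  | AnnCons m _ _ _ _ _ Phi' => maxn m (ann_width Phi')
  end.

Lemma ann_dim_gt0 (R : Type) (m n : nat) (Phi : ann R m n) :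
  (0 < m)%N && (0 < n)%N.
Proof. by elim: Phi => [m' n' -> -> //|m' k n' -> _ _ _ /andP[_ ->]]. Qed.

Lemma ann_dim_le_width (R : Type) (m n : nat) (Phi : ann R m n) :
  (m <= ann_width Phi)%N && (n <= ann_width Phi)%N.
Proof.
elim: Phi => [m' n' *|m' k n' _ _ _ Phi /andP[_ hn]] /=.
  by rewrite leq_maxl leq_maxr.
by rewrite leq_maxl (leq_trans hn) // leq_maxr.
Qed.

(** A layer with m inputs and k outputs has k (m + 1) parameters, which dominates both dimensions
    because they are positive. The final count uses this to replace the width of [Phi] by its number
    of parameters. *)
Lemma ann_width_le_params (R : Type) (m n : nat) (Phi : ann R m n) :
  (ann_width Phi <= ann_params Phi)%N.
Proof.
elim: Phi => [m' n' hm hn _ _|m' k n' hm _ _ Phi IH] /=; first by nia.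
have /andP[hk _] := ann_dim_gt0 Phi; nia.
Qed.

Lemma ann_length_gt0 (R : Type) (m n : nat) (Phi : ann R m n) :
  (0 < ann_length Phi)%N.
Proof. by case: Phi. Qed.

(** Each layer has at most w^2 weights and w biases. *)
Lemma ann_params_le (R : Type) (m n w : nat) (Phi : ann R m n) :
  (ann_width Phi <= w)%N ->
  (ann_params Phi <= ann_length Phi * (w * w.+1))%N.
Proof.
elim: Phi => [m' n' _ _ _ _|m' k n' _ _ _ Phi IH] /=.
  by rewrite geq_max mul1n addn1 => /andP[hm hn]; rewrite leq_mul.
rewrite geq_max => /andP[hm hw]; rewrite mulSn leq_add ?IH // addn1.
have /andP[hk _] := ann_dim_le_width Phi.
by rewrite leq_mul // (leq_trans hk).
Qed.

Section Nets.
Context {R : pzRingType} (a : R -> R).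

(* H counts hidden layers; w also bounds the input and output dimensions. *)
Definition net (H w m n : nat) (F : 'cV[R]_m -> 'cV[R]_n) : Prop :=
  exists Phi : ann R m n,
    [/\ ann_length Phi = H.+1, (ann_width Phi <= w)%N
      & ann_realize a Phi =1 F].

Lemma net_ext H w m n (F G : 'cV[R]_m -> 'cV[R]_n) :
  net H w F -> F =1 G -> net H w G.
Proof. by move=> [Phi [h1 h2 h3]] FG; exists Phi; split=> // x; rewrite h3. Qed.

Lemma net_weaken H w w' m n (F : 'cV[R]_m -> 'cV[R]_n) :
  (w <= w')%N -> net H w F -> net H w' F.
Proof.
by move=> ww' [Phi [h1 h2 h3]]; exists Phi; split=> //; apply: leq_trans ww'.
Qed.

Lemma net_ann m n (Phi : ann R m n) :
  net (ann_hidden Phi) (ann_width Phi) (ann_realize a Phi).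
Proof. by exists Phi; split=> //; rewrite prednK // ann_length_gt0. Qed.

Lemma net_affine w m n (W : 'M[R]_(n, m)) (B : 'cV[R]_n) :
  (0 < m <= w)%N -> (0 < n <= w)%N -> net 0 w (fun x => W *m x + B).
Proof.
move=> /andP[m0 mw] /andP[n0 nw]; exists (AnnLast m0 n0 W B).
by split=> //=; rewrite geq_max mw.
Qed.

Lemma net_linear w m n (W : 'M[R]_(n, m)) :
  (0 < m <= w)%N -> (0 < n <= w)%N -> net 0 w (fun x => W *m x).
Proof.
move=> hm hn; apply: net_ext (net_affine W 0 hm hn) _ => x.
by rewrite addr0.
Qed.

Lemma net_shallow w m k n (W1 : 'M[R]_(k, m)) B1 (W2 : 'M[R]_(n, k)) B2 :
  (0 < m <= w)%N -> (0 < k <= w)%N -> (0 < n <= w)%N ->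
  net 1 w (fun x => W2 *m map_mx a (W1 *m x + B1) + B2).
Proof.
move=> /andP[m0 mw] /andP[k0 kw] /andP[n0 nw].
exists (AnnCons m0 W1 B1 (AnnLast k0 n0 W2 B2)).
by split=> //=; rewrite !geq_max mw kw.
Qed.

(* The last affine map of Phi is merged with the first one of Psi, so that no
   layer is inserted between them. *)
Lemma net_comp H1 H2 w m k n (F : 'cV[R]_m -> 'cV[R]_k)
    (G : 'cV[R]_k -> 'cV[R]_n) :
  net H1 w F -> net H2 w G -> net (H1 + H2) w (G \o F).
Proof.
move=> [Phi [h1 h2 h3]] [Psi [k1 k2 k3]].
suff [Chi [c1 c2 c3]] : net (H1 + H2) w (ann_realize a Psi \o ann_realize a
  Phi).
  by exists Chi; split=> // x; rewrite c3 /= h3 k3.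
elim: Phi H1 h1 h2 n Psi H2 k1 k2 {F G h3 k3}
    => [m' k' m0 k0 W B|m' l k' m0 W B Phi IH] H1 /= h1 h2 n Psi H2 k1 k2.
  case: h1 => <-; rewrite add0n; move: h2; rewrite geq_max => /andP[mw _].
  case: Psi k1 k2 W B => [p n' p0 n0 W' B'|p l n' p0 W' B' Psi] /=;
    rewrite geq_max => k1 /andP[_ k2] W B.
    case: k1 => <-; exists (AnnLast m0 n0 (W' *m W) (W' *m B + B')).
    split=> //=; first by rewrite geq_max mw.
    by move=> x /=; rewrite mulmxDr addrA mulmxA.
  exists (AnnCons m0 (W' *m W) (W' *m B + B') Psi).
  split=> //=; first by rewrite geq_max mw.
  by move=> x /=; rewrite mulmxDr addrA mulmxA.
move: h2; rewrite geq_max => /andP[mw h2].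
case: H1 h1 => [|H1] h1; first by have := ann_length_gt0 Phi; case: h1 => ->.
have [Chi [c1 c2 c3]] := IH H1 (succn_inj h1) h2 _ Psi H2 k1 k2.
exists (AnnCons m0 W B Chi); split=> /=.
- by rewrite c1 addSn.
- by rewrite geq_max mw.
- by move=> x; rewrite c3.
Qed.

(** Block-diagonal hidden layers run the two networks side by side, and the last layer, a row of two
    blocks, adds their outputs. Equal lengths make the layers match. *)
Lemma ann_sum_exists m1 m2 n (Phi1 : ann R m1 n) (Phi2 : ann R m2 n) :
  ann_length Phi1 = ann_length Phi2 ->
  exists Phi : ann R (m1 + m2) n,
    [/\ ann_length Phi = ann_length Phi1,
        (ann_width Phi <= ann_width Phi1 + ann_width Phi2)%N
      & forall x1 x2, ann_realize a Phi (col_mx x1 x2)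
                      = ann_realize a Phi1 x1 + ann_realize a Phi2 x2].
Proof.
elim: Phi1 m2 Phi2 => [m' n' m0 n0 W B|m' l n' m0 W B Phi1 IH] m2 Phi2.
  case: Phi2 n0 W B => [m2' n2 m20 n20 W' B'|m2' l2 n2 m20 W' B' Phi2]
      n0 W B /= hl; last first.
    by case: hl (ann_length_gt0 Phi2) => <-.
  have m12 : (0 < m' + m2')%N by rewrite addn_gt0 m0.
  exists (AnnLast m12 n0 (row_mx W W') (B + B')); split=> //=.
    by rewrite geq_max leq_add ?leq_maxl //= (leq_trans (leq_maxr m' n2)) //
      leq_addr.
  by move=> x1 x2; rewrite mul_row_col addrACA.
case: Phi2 Phi1 IH => [m2' n2 m20 n20 W' B'|m2' l2 n2 m20 W' B' Phi2]
    Phi1 IH /= hl.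
  by case: hl (ann_length_gt0 Phi1) => ->.
have [Phi [c1 c2 c3]] := IH _ Phi2 (succn_inj hl).
have m12 : (0 < m' + m2')%N by rewrite addn_gt0 m0.
exists (AnnCons m12 (block_mx W 0 0 W') (col_mx B B') Phi); split=> /=.
- by rewrite c1.
- by rewrite geq_max leq_add ?leq_maxl //= (leq_trans c2) // leq_add ?leq_maxr.
- move=> x1 x2.
  by rewrite mul_block_col !mul0mx addr0 add0r add_col_mx map_col_mx c3.
Qed.

Lemma net_add H w1 w2 m n (F G : 'cV[R]_m -> 'cV[R]_n) :
  net H w1 F -> net H w2 G -> net H (w1 + w2) (fun x => F x + G x).
Proof.
move=> [Phi [h1 h2 h3]] [Psi [k1 k2 k3]].
have /andP[m0 _] := ann_dim_gt0 Phi.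
have [mw1 mw2] : (m <= w1)%N /\ (m <= w2)%N.
  have /andP[? _] := ann_dim_le_width Phi.
  have /andP[? _] := ann_dim_le_width Psi.
  by split; [apply: leq_trans h2 | apply: leq_trans k2].
have [Chi [c1 c2 c3]] := ann_sum_exists (etrans h1 (esym k1)).
(* Duplicating the input is affine, so [net_comp] absorbs it without a new hidden layer. *)
have dup : net 0 (w1 + w2) (fun x : 'cV[R]_m => col_mx 1%:M 1%:M *m x).
  by apply: net_linear;
    rewrite ?addn_gt0 m0 /= ?leq_add // (leq_trans mw1) // leq_addr.
have Chin : net H (w1 + w2) (ann_realize a Chi).
  by exists Chi; split=> //; [rewrite c1 | apply: leq_trans c2 (leq_add h2 k2)].
apply: net_ext (net_comp dup Chin) _ => x /=.
by rewrite mul_col_mx !mul1mx c3 h3 k3.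
Qed.

Lemma net_sum H w m n p (F : 'I_p -> 'cV[R]_m -> 'cV[R]_n) :
  (0 < p)%N -> (forall i, net H w (F i)) ->
  net H (p * w) (fun x => \sum_i F i x).
Proof.
case: p F => [//|p] F _; elim: p F => [|p IH] F hF.
  by rewrite mul1n; apply: net_ext (hF ord0) _ => x; rewrite big_ord1.
rewrite mulSnr.
apply: net_ext (net_add (IH _ (fun i => hF (widen_ord (leqnSn _) i)))
  (hF ord_max)) _ => x.
by rewrite [RHS]big_ord_recr.
Qed.

Lemma net_post H w m n p (W : 'M[R]_(p, n)) (F : 'cV[R]_m -> 'cV[R]_n) :
  (0 < p <= w)%N -> net H w F -> net H w (fun x => W *m F x).
Proof.
move=> hp hF; have [Phi [_ h2 _]] := hF.
have /andP[_ n0] := ann_dim_gt0 Phi; have /andP[_ nw] := ann_dim_le_width Phi.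
have hl : net 0 w (fun x => W *m x).
  by apply: net_linear; rewrite // n0 (leq_trans nw).
by have := net_comp hF hl; rewrite addn0.
Qed.

Lemma net_pre H w m n p (W : 'M[R]_(m, p)) (F : 'cV[R]_m -> 'cV[R]_n) :
  (0 < p <= w)%N -> net H w F -> net H w (fun x => F (W *m x)).
Proof.
move=> hp hF; have [Phi [_ h2 _]] := hF.
have /andP[m0 _] := ann_dim_gt0 Phi; have /andP[mw _] := ann_dim_le_width Phi.
have hl : net 0 w (fun x => W *m x).
  by apply: net_linear; rewrite // m0 (leq_trans mw).
exact: net_comp hl hF.
Qed.

End Nets.

Section ReluNets.
Context {R : realType}.

Definition relu (x : R) : R := Num.max x 0.

Lemma relu_sub (x : R) : relu x - relu (- x) = x.
Proof. rewrite /relu; case: (lerP x 0); case: (lerP (- x) 0); lra. Qed.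

(** Each hidden layer carries x as the pair relu x, relu (- x), whence the doubled width. *)
Lemma net_id H n : (0 < n)%N -> net relu H (n + n) (@id 'cV[R]_n).
Proof.
move=> n0; have hn : (0 < n <= n + n)%N by rewrite n0 leq_addr.
elim: H => [|H IH].
  by apply: net_ext (net_linear relu 1%:M hn hn) _ => x; rewrite mul1mx.
have id1 : net relu 1 (n + n) (@id 'cV[R]_n).
  have hnn : (0 < n + n <= n + n)%N by rewrite addn_gt0 n0 leqnn.
  apply: net_ext (net_shallow relu (col_mx 1%:M (- 1%:M)) 0
    (row_mx 1%:M (- 1%:M)) 0 hn hnn hn) _ => x.
  rewrite !addr0 mul_col_mx map_col_mx mul_row_col mulNmx !mulNmx !mul1mx.
  by apply/matrixP => i j; rewrite !mxE relu_sub.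
exact: net_comp id1 IH.
Qed.

(** Pads a network with identity layers, to reach the equal depths that [net_add] asks for. *)
Lemma net_deepen K H w m n (F : 'cV[R]_m -> 'cV[R]_n) :
  (n + n <= w)%N -> net relu H w F -> net relu (H + K) w F.
Proof.
move=> nw hF; have [Phi _] := hF; have /andP[_ n0] := ann_dim_gt0 Phi.
exact: net_comp hF (net_weaken nw (net_id K n0)).
Qed.

End ReluNets.

(** * Approximate multiplication by a number in [0, 1] *)

Section Product.
Context {R : realType}.
Implicit Types (x y : R) (k : nat).

Local Notation i0 := ord0.
Local Notation i1 := (lift ord0 ord0).
Local Notation i2 := (lift ord0 (lift ord0 ord0)).

Definition mxseq m n (s : seq (seq R)) : 'M[R]_(m, n) :=
  \matrix_(i, j) (nth [::] s i)`_j.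

Definition vec2 x y : 'cV[R]_2 := mxseq 2 1 [:: [:: x]; [:: y]].

Definition vec3 x y z : 'cV[R]_3 := mxseq 3 1 [:: [:: x]; [:: y]; [:: z]].

(** On [0, 1] this is the tent map: 2 x up to 1/2, then 2 - 2 x. *)
Definition tent x : R := 2 * relu x - 4 * relu (x - 2^-1).

Lemma relu_ge0 x : 0 <= x -> relu x = x.
Proof. by rewrite /relu => /max_idPl. Qed.

Lemma relu_le0 x : x <= 0 -> relu x = 0.
Proof. by rewrite /relu => /max_idPr. Qed.

Lemma tent_itv x : 0 <= x <= 1 -> 0 <= tent x <= 1.
Proof.
move=> /andP[x0 x1]; rewrite /tent (relu_ge0 x0).
by have [h|h] := leP x 2^-1; [rewrite relu_le0 | rewrite relu_ge0]; lra.
Qed.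

(** On the left half the right side is 2 x + 2 x (1 - 2 x); the right half is its mirror image under
    x -> 1 - x. *)
Lemma tent_logistic x : 0 <= x <= 1 ->
  4 * (x * (1 - x)) = tent x + tent x * (1 - tent x).
Proof.
move=> /andP[x0 x1]; rewrite /tent (relu_ge0 x0).
by have [h|h] := leP x 2^-1; [rewrite relu_le0 | rewrite relu_ge0]; lra.
Qed.

Lemma relu_addN x : relu x + relu (- x) = `|x|.
Proof.
have [h|h] := leP 0 x; [rewrite relu_ge0 // ger0_norm // relu_le0 |
  rewrite relu_le0 ?ltr0_norm // ?relu_ge0]; lra.
Qed.

Definition clip (B y : R) : R := relu (y + B) - relu (y - B) - B.

Lemma clipP (B y : R) : 0 <= B ->
  [\/ `|y| <= B /\ clip B y = y, B < y /\ clip B y = B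
    | y < - B /\ clip B y = - B].
Proof.
move=> B0; rewrite /clip; have [h|h] := leP `|y| B.
  apply: Or31; split=> //; move: h; rewrite ler_norml => /andP[h1 h2].
  by rewrite relu_ge0 ?relu_le0; lra.
have [hy|hy] := leP 0 y.
  by apply: Or32; rewrite ger0_norm // in h; split=> //; rewrite !relu_ge0; lra.
by apply: Or33; rewrite ltr0_norm // in h; split; [lra|rewrite !relu_le0; lra].
Qed.

Lemma clip_norm_le (B y : R) : 0 <= B -> `|clip B y| <= B.
Proof.
move=> B0; case: (clipP y B0) => -[h ->] //; first by rewrite ger0_norm.
by rewrite normrN ger0_norm.
Qed.

Lemma clip_norm_le_arg (B y : R) : 0 <= B -> `|clip B y| <= `|y|.
Proof.
move=> B0; case: (clipP y B0) => -[h ->] //.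
  by rewrite !ger0_norm; lra.
by rewrite normrN ger0_norm // ltr0_norm; lra.
Qed.

(** The first factor will lie in [0, 1], where [relu] leaves it unchanged; the second is clipped and
    scaled into [-1, 1]. *)
Definition prod_scale k (p : 'cV[R]_2) : 'cV[R]_2 :=
  vec2 (relu (p i0 i0)) (clip (2 ^+ k) (p i1 i0) / 2 ^+ k).

(** The state consists of u = |x + z| / 2 and v = |x - z| / 2, which [prod_step] moves by the tent
    map, and of an accumulator that starts at u - v. *)
Definition prod_init (p : 'cV[R]_2) : 'cV[R]_3 :=
  let u := (relu (p i0 i0 + p i1 i0) + relu (- p i0 i0 - p i1 i0)) / 2 in
  let v := (relu (p i0 i0 - p i1 i0) + relu (- p i0 i0 + p i1 i0)) / 2 in
  vec3 u v (u - v).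

Definition prod_step (s : 'cV[R]_3) : 'cV[R]_3 :=
  vec3 (tent (s i0 i0)) (tent (s i1 i0))
       (4 * s i2 i0 - tent (s i0 i0) + tent (s i1 i0)).

(** After k steps the accumulator is close to 4^k x z, where z is the clipped y divided by 2^k.
    Dividing it by 2^k therefore gives nearly x times the clipped y. *)
Definition relu_prod k x y : R :=
  iter k prod_step (prod_init (prod_scale k (vec2 x y))) i2 i0 / 2 ^+ k.

Lemma vec3E x y z : (vec3 x y z i0 i0 = x) * (vec3 x y z i1 i0 = y)
  * (vec3 x y z i2 i0 = z).
Proof. by rewrite /vec3 !mxE. Qed.

Lemma vec2E x y : (vec2 x y i0 i0 = x) * (vec2 x y i1 i0 = y).
Proof. by rewrite /vec2 !mxE. Qed.

Lemma vec2P (p q : 'cV[R]_2) :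
  p i0 i0 = q i0 i0 -> p i1 i0 = q i1 i0 -> p = q.
Proof.
move=> h0 h1; apply/matrixP => i j; rewrite (ord1 j).
case: (unliftP i0 i) => [i'|] ->; last exact: h0.
by rewrite (ord1 i'); exact: h1.
Qed.

Lemma vec3P (p q : 'cV[R]_3) :
  p i0 i0 = q i0 i0 -> p i1 i0 = q i1 i0 -> p i2 i0 = q i2 i0 -> p = q.
Proof.
move=> h0 h1 h2; apply/matrixP => i j; rewrite (ord1 j).
case: (unliftP i0 i) => [i'|] ->; last exact: h0.
case: (unliftP i0 i') => [i''|] ->; last exact: h1.
by rewrite (ord1 i''); exact: h2.
Qed.

Lemma net_prod_scale k : net relu 1 6 (prod_scale k).
Proof.
pose B : R := 2 ^+ k.
apply: net_ext (net_shallow relu (w := 6) (k := 3)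
  (mxseq 3 2 [:: [:: 1; 0]; [:: 0; 1]; [:: 0; 1]])
  (vec3 0 B (- B)) (mxseq 2 3 [:: [:: 1; 0; 0]; [:: 0; B^-1; - B^-1]])
  (vec2 0 (- 1)) isT isT isT) _ => p.
have B0 : B != 0 by rewrite expf_neq0 // pnatr_eq0.
apply: vec2P; rewrite !mxE !big_ord_recl big_ord0 !mxE !big_ord_recl !big_ord0
  !mxE /= /prod_scale /clip -/B.
- by rewrite !(mul1r, mul0r, addr0, add0r).
- rewrite !(mul1r, mul0r, addr0, add0r).
  by field.
Qed.

Lemma net_prod_init : net relu 1 6 prod_init.
Proof.
apply: net_ext (net_shallow relu (w := 6) (k := 4)
  (mxseq 4 2 [:: [:: 1; 1]; [:: -1; -1]; [:: 1; -1]; [:: -1; 1]]) 0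
  (mxseq 3 4 [:: [:: 2^-1; 2^-1; 0; 0]; [:: 0; 0; 2^-1; 2^-1];
                 [:: 2^-1; 2^-1; -2^-1; -2^-1]]) 0 isT isT isT) _ => p.
apply: vec3P; rewrite !mxE !big_ord_recl big_ord0 !mxE !big_ord_recl !big_ord0
  !mxE /= !(mul1r, mul0r, addr0, add0r, mulN1r); ring.
Qed.

(** Two neurons serve each tent map, and two more carry the accumulator, which may have either
    sign. *)
Lemma net_prod_step : net relu 1 6 prod_step.
Proof.
apply: net_ext (net_shallow relu (w := 6) (k := 6)
  (mxseq 6 3 [:: [:: 1; 0; 0]; [:: 1; 0; 0]; [:: 0; 1; 0]; [:: 0; 1; 0];
                 [:: 0; 0; 1]; [:: 0; 0; -1]])
  (mxseq 6 1 [:: [:: 0]; [:: - 2^-1]; [:: 0]; [:: - 2^-1]; [:: 0]; [:: 0]])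
  (mxseq 3 6 [:: [:: 2; -4; 0; 0; 0; 0]; [:: 0; 0; 2; -4; 0; 0];
                 [:: -2; 4; 2; -4; 4; -4]]) 0 isT isT isT) _ => s.
apply: vec3P; rewrite !mxE !big_ord_recl big_ord0 !mxE !big_ord_recl !big_ord0
  !mxE /= !(mul1r, mul0r, addr0, add0r, mulN1r) /tent; try ring.
by rewrite -[in RHS](relu_sub (s i2 i0)); ring.
Qed.

(** One hidden layer scales, one initializes, and each of the k iterations adds one. *)
Lemma net_relu_prod k : net relu k.+2 6
  (fun p : 'cV[R]_2 => const_mx (relu_prod k (p i0 i0) (p i1 i0)) : 'cV[R]_1).
Proof.
have hiter : net relu k 6 (iter k prod_step).
  elim: k => [|k IH].
    apply: net_ext (net_linear relu 1%:M _ _) _ => // x; by rewrite mul1mx.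
  by have := net_comp IH net_prod_step; rewrite addn1.
have hcomp := net_comp (net_prod_scale k) (net_comp net_prod_init hiter).
apply: net_ext (net_post (w := 6) (mxseq 1 3 [:: [:: 0; 0;
  (2 ^+ k)^-1]]) isT hcomp) _.
move=> p; apply/matrixP => i j; rewrite (ord1 i) (ord1 j).
rewrite [RHS]mxE /relu_prod (_ : vec2 _ _ = p); last first.
  by apply: vec2P; rewrite vec2E.
by rewrite mxE !big_ord_recl big_ord0 !mxE /= !mul0r !add0r addr0 mulrC.
Qed.

(** For x = 0 the two tent orbits start at the same point, so they stay equal and the accumulator
    stays 0. *)
Lemma relu_prod0 k y : relu_prod k 0 y = 0.
Proof.
rewrite /relu_prod.
have H n : let s := iter n prod_step (prod_init (prod_scale k (vec2 0 y))) in
    s i0 i0 = s i1 i0 /\ s i2 i0 = 0.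
  elim: n => [|n [e1 e2]] /=; rewrite !vec3E.
    rewrite !vec2E (relu_ge0 (lexx 0)) !add0r oppr0 !sub0r !add0r addrC.
    by split=> //; rewrite subrr.
  by rewrite e1 e2 mulr0 sub0r addNr.
by rewrite (H k).2 mul0r.
Qed.

(* With the logistic map r(s) = s (1 - s), which satisfies
   4 r(s) = T(s) + r(T(s)) for the tent map T, and u = |x + z| / 2,
   v = |x - z| / 2, one has x z = u^2 - v^2 = (u - v) - r(u) + r(v); a step
   multiplies A - r(u) + r(v) by 4. *)
Lemma relu_prod_clip k x y : 0 <= x <= 1 ->
  `|relu_prod k x y - x * clip (2 ^+ k) y| <= (2 ^+ k)^-1.
Proof.
move=> /andP[x0 x1]; rewrite /relu_prod; set B : R := 2 ^+ k.
have B0 : 0 < B by rewrite exprn_gt0.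
pose z := clip B y / B.
have z1 : `|z| <= 1.
  by rewrite normrM normfV (gtr0_norm B0) ler_pdivrMr // mul1r clip_norm_le //
    ltW.
have /andP[zl zr] : -1 <= z <= 1 by rewrite -ler_norml.
pose s n := iter n prod_step (prod_init (prod_scale k (vec2 x y))).
have inv n : [/\ 0 <= s n i0 i0 <= 1, 0 <= s n i1 i0 <= 1
   & s n i2 i0 - s n i0 i0 * (1 - s n i0 i0) + s n i1 i0 * (1 - s n i1 i0)
     = 4 ^+ n * (x * z)].
  rewrite /s; elim: n => [|n [h1 h2 h3]] /=; rewrite !vec3E.
    rewrite !vec2E -/B -/z (relu_ge0 x0) expr0 mul1r.
    have -> : - x - z = - (x + z) by ring.
    have -> : - x + z = - (x - z) by ring.
    rewrite !relu_addN.
    have [a1|a1] := leP 0 (x + z); have [a2|a2] := leP 0 (x - z);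
      rewrite ?(ger0_norm a1) ?(ger0_norm a2) ?(ltr0_norm a1) ?(ltr0_norm a2);
      split; try nra.
  rewrite !tent_itv // exprS -mulrA -h3; split=> //.
  by have := tent_logistic h1; have := tent_logistic h2; lra.
rewrite -/(s k); have [su sv sA] := inv k.
(* The error is the difference of two values of s (1 - s) at points of [0, 1], divided by 2^k; both
   values lie in [0, 1]. *)
have -> : s k i2 i0 / B - x * clip B y
   = (s k i0 i0 * (1 - s k i0 i0) - s k i1 i0 * (1 - s k i1 i0)) / B.
  have -> : s k i2 i0 = 4 ^+ k * (x * z) + s k i0 i0 * (1 - s k i0 i0)
     - s k i1 i0 * (1 - s k i1 i0) by rewrite -sA; ring.
  have -> : 4 ^+ k = B * B :> R by rewrite -exprMn -natrM.
  by rewrite /z; field; rewrite gt_eqF.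
rewrite normrM normfV (gtr0_norm B0) ler_piMl ?invr_ge0 ?(ltW B0) //.
by rewrite ler_norml; move: su sv => /andP[? ?] /andP[? ?]; apply/andP; split;
  nra.
Qed.

(** If |y| <= 2^k, clipping does nothing and the error is at most e. Otherwise |y| > 2^k >= 1 / e
    gives |y| <= e y^2, and the clipping loss |y| - 2^k plus e is at most |y| because e <= 1 <=
    2^k. *)
Lemma relu_prod_error k (e x y : R) : 0 <= x <= 1 -> e <= 1 ->
  (2 ^+ k)^-1 <= e ->
  `|x * y - relu_prod k x y| <= e * Num.max 1 (y ^+ 2).
Proof.
move=> x01 e1 ke; have := relu_prod_clip k y x01; set M := relu_prod k x y.
set B : R := 2 ^+ k in ke *; move=> hM.
have B0 : 0 < B by rewrite exprn_gt0.
have e0 : 0 < e by rewrite (lt_le_trans _ ke) // invr_gt0.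
have eB : 1 <= e * B by rewrite -ler_pdivrMr // div1r.
have {}hM : `|M - x * clip B y| <= e by apply: le_trans ke.
have B1 : 1 <= B by nra.
case: (clipP y (ltW B0)) => -[h hc]; rewrite hc in hM.
- by rewrite distrC (le_trans hM) // ler_peMr ?(ltW e0) // le_max lexx /=.
- apply: (@le_trans _ _ (e * y ^+ 2)); last first.
    by rewrite ler_pM2l // le_max lexx orbT.
  move: hM; rewrite !ler_norml => /andP[h1 h2]; move: x01 => /andP[? ?].
  have ? : 1 <= e * y by nra.
  have ? : x * (y - B) <= y - B by nra.
  have ? : 0 <= x * (y - B) by nra.
  have ? : y <= e * y ^+ 2 by nra.
  by apply/andP; split; nra.
- apply: (@le_trans _ _ (e * y ^+ 2)); last first.
    by rewrite ler_pM2l // le_max lexx orbT.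
  move: hM; rewrite !ler_norml => /andP[h1 h2]; move: x01 => /andP[? ?].
  have ? : 1 <= e * - y by nra.
  have ? : x * (- y - B) <= - y - B by nra.
  have ? : 0 <= x * (- y - B) by nra.
  have ? : - y <= e * y ^+ 2 by nra.
  by apply/andP; split; nra.
Qed.

(** The approximation error is at most 1, and clipping does not increase |y|. The bound does not
    depend on k. *)
Lemma relu_prod_norm_le k x y : 0 <= x <= 1 ->
  `|relu_prod k x y| <= 1 + `|y|.
Proof.
move=> x01; rewrite -(subrK (x * clip (2 ^+ k) y) (relu_prod k x y)).
rewrite (le_trans (ler_normD _ _)) // lerD //.
  by rewrite (le_trans (relu_prod_clip _ _ x01)) // invf_le1 ?exprn_gt0
    ?exprn_ege1 // ler1n.
rewrite (le_trans _ (@clip_norm_le_arg (2 ^+ k) y _)) ?exprn_ge0 //.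
by move: x01 => /andP[? ?]; rewrite normrM ger0_norm // ler_piMl.
Qed.

End Product.

(** * Euclidean norm and continuity *)

Section EuclideanNorm.
Context {R : rcfType} {n : nat}.
Implicit Types x y : 'cV[R]_n.

Lemma enorm_ge0 x : 0 <= enorm x.
Proof. exact: sqrtr_ge0. Qed.

Lemma enorm_sqr x : enorm x ^+ 2 = \sum_i x i ord0 ^+ 2.
Proof. by rewrite sqr_sqrtr // sumr_ge0 // => i _; rewrite sqr_ge0. Qed.

(** Cauchy-Schwarz. With A = |x|^2, B = |y|^2 and c the inner product, B (A B - c^2) is the sum of
    the squares (B x_i - c y_i)^2. Dividing by B needs B > 0; for B = 0 the vector y vanishes. *)
Lemma sum_mul_sqr_le x y :
  (\sum_i x i ord0 * y i ord0) ^+ 2 <= enorm x ^+ 2 * enorm y ^+ 2.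
Proof.
rewrite !enorm_sqr; set c := \sum_i _; set A := \sum_i _; set B := \sum_i _.
have H : 0 <= B * (A * B - c ^+ 2).
  have -> : B * (A * B - c ^+ 2) = \sum_i (B * x i ord0 - c * y i ord0) ^+ 2.
    rewrite (eq_bigr (fun i => B ^+ 2 * x i ord0 ^+ 2
        - (2 * B * c) * (x i ord0 * y i ord0) + c ^+ 2 * y i ord0 ^+ 2)).
      rewrite big_split sumrB -!mulr_sumr /=; rewrite -/A -/B -/c; ring.
    by move=> i _; ring.
  by apply: sumr_ge0 => i _; apply: sqr_ge0.
have B0 : 0 <= B by apply: sumr_ge0 => i _; apply: sqr_ge0.
have [B_gt0|] := ltP 0 B; first by rewrite pmulr_rge0 // subr_ge0 in H.
move=> B_le0; have {B0 B_le0} BE : B = 0 by apply/eqP; rewrite eq_le B_le0.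
have y0 i : y i ord0 = 0.
  apply/eqP; rewrite -sqrf_eq0; apply/eqP; move: i isT.
  by apply: psumr_eq0P BE => i _; apply: sqr_ge0.
by rewrite BE mulr0 /c big1 ?expr0n // => i _; rewrite y0 mulr0.
Qed.

Lemma ler_enormD x y : enorm (x + y) <= enorm x + enorm y.
Proof.
have hx := enorm_ge0 x; have hy := enorm_ge0 y.
rewrite -(@ler_pXn2r _ 2) ?nnegrE ?addr_ge0 ?enorm_ge0 //.
rewrite sqrrD enorm_sqr.
rewrite (eq_bigr (fun i => x i ord0 ^+ 2 + 2 * (x i ord0 * y i ord0)
    + y i ord0 ^+ 2)); last by move=> i _; rewrite mxE; ring.
rewrite !big_split -mulr_sumr -!enorm_sqr /= lerD2r lerD2l.
rewrite -[leRHS]mulr_natl ler_pM2l ?ltr0n // (le_trans (ler_norm _)) //.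
rewrite -(@ler_pXn2r _ 2) ?nnegrE ?mulr_ge0 // real_normK ?num_real // exprMn.
exact: sum_mul_sqr_le.
Qed.

Lemma enorm0 : enorm (0 : 'cV[R]_n) = 0.
Proof.
by rewrite /enorm big1 ?sqrtr0 // => i _; rewrite mxE expr0n.
Qed.

Lemma enormZ (c : R) x : enorm (c *: x) = `|c| * enorm x.
Proof.
rewrite /enorm -sqrtr_sqr -sqrtrM ?sqr_ge0 // mulr_sumr.
by congr Num.sqrt; apply: eq_bigr => i _; rewrite mxE exprMn.
Qed.

Lemma enorm_const (c : R) : 0 <= c -> enorm (const_mx c : 'cV[R]_n) = c *
  Num.sqrt n%:R.
Proof.
move=> c0; rewrite /enorm (eq_bigr (fun=> c ^+ 2)); last by move=> i _;
  rewrite mxE.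
rewrite sumr_const card_ord -[c ^+ 2 *+ n]mulr_natr sqrtrM ?sqr_ge0 //.
by rewrite sqrtr_sqr ger0_norm.
Qed.

Lemma coord_le_enorm x i : `|x i ord0| <= enorm x.
Proof.
rewrite -sqrtr_sqr ler_sqrt; last by rewrite sumr_ge0 // => j _;
  rewrite sqr_ge0.
by rewrite (bigD1 i) //= lerDl sumr_ge0 // => j _; rewrite sqr_ge0.
Qed.

(** The norm is monotone in the absolute values of the coordinates, so the triangle inequality for
    the constant vector b and c |y| applies. *)
Lemma enorm_le_coord x y (b c : R) : 0 <= b -> 0 <= c ->
  (forall i, `|x i ord0| <= b + c * `|y i ord0|) ->
  enorm x <= b * Num.sqrt n%:R + c * enorm y.
Proof.
move=> b0 c0 h; pose z : 'cV[R]_n := const_mx b + c *: map_mx Num.norm y.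
have -> : b * Num.sqrt n%:R + c * enorm y
  = enorm (const_mx b : 'cV[R]_n) + enorm (c *: map_mx Num.norm y).
  rewrite enorm_const // enormZ ger0_norm //; congr (_ + _ * Num.sqrt _).
  by apply: eq_bigr => i _; rewrite mxE real_normK ?num_real.
apply: le_trans (ler_enormD _ _); rewrite -/z ler_sqrt; last first.
  by rewrite sumr_ge0 // => j _; rewrite sqr_ge0.
apply: ler_sum => i _; rewrite -[leLHS]real_normK ?num_real //.
have hz : z i ord0 = b + c * `|y i ord0| by rewrite !mxE.
by rewrite hz ler_pXn2r ?nnegrE // addr_ge0 // mulr_ge0.
Qed.

Lemma enorm_sum_le p (F : 'I_p -> 'cV[R]_n) :
  enorm (\sum_i F i) <= \sum_i enorm (F i).
Proof.
elim/big_ind2: _ => [|v r w s hv hw|//]; first by rewrite enorm0.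
by apply: le_trans (ler_enormD _ _) _; apply: lerD.
Qed.

End EuclideanNorm.

Section Continuity.
Context {R : realType}.
Implicit Type T : topologicalType.

Lemma mx_continuous T m n (F : T -> 'M[R]_(m, n)) :
  (forall i j, continuous (fun t => F t i j)) -> continuous F.
Proof.
move=> h t A [P hP sPA].
have : \forall u \near t, forall ij : 'I_m * 'I_n, P ij.1 ij.2 (F u ij.1 ij.2).
  by apply: filter_forall => -[i j]; apply: h; apply: hP.
by apply: filterS => u hu; apply: sPA => i j; apply: (hu (i, j)).
Qed.

Lemma sum_continuous T (I : Type) (r : seq I) (P : pred I) (f : I -> T -> R) :
  (forall i, P i -> continuous (f i)) ->
  continuous (fun t => \sum_(i <- r | P i) f i t).
Proof.
move=> h t; apply: cvg_big => [|i Pi]; last exact: h.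
exact: add_continuous.
Qed.

Lemma mulmx_continuous T m n p (A : 'M[R]_(m, n)) (F : T -> 'M[R]_(n, p)) :
  continuous F -> continuous (fun t => A *m F t).
Proof.
move=> hF; apply: mx_continuous => i j.
rewrite (_ : (fun t => _) = fun t => \sum_k A i k * F t k j); last first.
  by apply/funext => t; rewrite mxE.
apply: sum_continuous => k _ t; apply: cvgM; first exact: cvg_cst.
exact: continuous_comp (hF t) (@coord_continuous _ _ _ k j _).
Qed.

Lemma mxD_continuous T m n (F G : T -> 'M[R]_(m, n)) :
  continuous F -> continuous G -> continuous (fun t => F t + G t).
Proof. by move=> hF hG t; apply: cvgD; [apply: hF | apply: hG]. Qed.

Lemma ann_realize_continuous (a : R -> R) m n (Phi : ann R m n) :
  continuous a -> continuous (ann_realize a Phi).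
Proof.
move=> ha; have aff m' n' (W : 'M[R]_(n', m')) B :
    continuous (fun x : 'cV[R]_m' => W *m x + B).
  apply: (@mxD_continuous _ _ _ (fun x => W *m x) (fun=> B)).
    by apply: (@mulmx_continuous _ _ _ _ W id) => t; apply: cvg_id.
  exact: cst_continuous.
elim: Phi => [m' n' hm hn W B|m' k n' hm W B Phi IH];
  first exact: (aff _ _ W B).
pose F := fun x : 'cV[R]_m' => map_mx a (W *m x + B).
suff hF : continuous F.
  by move=> x; exact: (@continuous_comp _ _ _ F (ann_realize a Phi) x (hF x)
    (IH _)).
apply: mx_continuous => i j x.
rewrite (_ : (fun t => _) = a \o (fun t => (W *m t + B) i j)); last first.
  by apply/funext => t; rewrite /= mxE.
apply: continuous_comp; last exact: ha.
exact: continuous_comp (aff _ _ _ _ x) (@coord_continuous _ _ _ i j _).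
Qed.

Lemma relu_continuous : continuous (@relu R).
Proof.
move=> x; apply: continuous_max; [exact: cvg_id | exact: cvg_cst].
Qed.

(** Continuity is inherited from the network that realizes [relu_prod]. *)
Lemma relu_prod_continuous k (x : R) : continuous (relu_prod k x).
Proof.
have [Phi [_ _ hPhi]] := @net_relu_prod R k.
rewrite (_ : relu_prod k x =
  (fun M : 'cV[R]_1 => M ord0 ord0) \o (ann_realize relu Phi \o vec2 x)).
  move=> y; apply: continuous_comp; last exact: coord_continuous.
  apply: continuous_comp; last exact: ann_realize_continuous relu_continuous _.
  move: y; apply: mx_continuous => i j y.
  case: (unliftP ord0 i) => [i'|] ->; rewrite ?(ord1 i') (ord1 j).
    rewrite (_ : (fun t => _) = id) => [|]; first exact: cvg_id.
    by apply/funext => t; rewrite vec2E.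
  rewrite (_ : (fun t => _) = fun=> x) => [|]; first exact: cvg_cst.
  by apply/funext => t; rewrite vec2E.
by apply/funext => y /=; rewrite hPhi mxE !vec2E.
Qed.

End Continuity.

(** * Euler iterates and hat functions *)

Section Euler.
Context {R : realType} {d N : nat} (f : 'cV[R]_d -> 'cV[R]_d) (h : R).
Implicit Types (x : 'cV[R]_d) (y z : 'M[R]_(d, N)).

(* The increment y_(m+1) is written as a difference of partial sums because m
   ranges over nat and the columns of y are indexed by 'I_N. *)
Fixpoint euler x y (n : nat) : 'cV[R]_d :=
  if n is m.+1 then
    euler x y m + (h *: f (euler x y m) + (psum y m.+1 - psum y m))
  else x.

Lemma psum0 y : psum y 0 = 0.
Proof. by rewrite /psum big_pred0. Qed.

Lemma psumS y (n : 'I_N) : psum y n.+1 = psum y n + col n y.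
Proof.
rewrite /psum (bigD1 n) //= addrC; congr (_ + _).
apply: eq_bigl => k; rewrite ltnS; apply/andP/idP => [[h1 h2]|h1].
  by rewrite ltn_neqAle h1 andbT.
by split; [exact: ltnW | apply: contraTneq h1 => ->; rewrite ltnn].
Qed.

Lemma psum_prefix y z (n m : nat) : (m <= n)%N ->
  (forall k : 'I_N, (k < n)%N -> col k y = col k z) -> psum y m = psum z m.
Proof.
move=> mn yz; apply: eq_bigr => k km; apply: yz; exact: leq_trans mn.
Qed.

Lemma euler_prefix x y z (n m : nat) : (m <= n)%N ->
  (forall k : 'I_N, (k < n)%N -> col k y = col k z) ->
  euler x y m = euler x z m.
Proof.
move=> mn yz; elim: m mn => //= m IH mn.
by rewrite (IH (ltnW mn)) (psum_prefix mn yz) (psum_prefix (ltnW mn) yz).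
Qed.

(** The increments telescope, so the noise enters through one partial sum. This is what permits a
    bound by [max_psum] instead of a sum of norms. *)
Lemma eulerE x y n :
  euler x y n = x + h *: (\sum_(k < n) f (euler x y k)) + psum y n.
Proof.
elim: n => [|n IH] /=; first by rewrite big_ord0 scaler0 psum0 !addr0.
rewrite big_ord_recr /= scalerDr {1}IH -!addrA; congr (_ + (_ + _)).
by rewrite addrCA [psum y n.+1 - _]addrC addNKr.
Qed.

Lemma enorm_psum_le y (m n : nat) : (m <= n)%N ->
  enorm (psum y m) <= max_psum y n.
Proof.
rewrite -ltnS => mn.
exact: (le_bigmax 0 (fun i : 'I_n.+1 => enorm (psum y i)) (Ordinal mn)).
Qed.

Lemma max_psum_ge0 y n : 0 <= max_psum y n.
Proof. by apply: le_trans (enorm_psum_le y (leq0n n)); apply: enorm_ge0. Qed.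

(** Discrete Gronwall inequality. The constant [al] is formed at the final index n, so that it
    serves all m <= n at once; [S] is the majorant, which grows at most by the factor 1 + h C per
    step. *)
Lemma euler_growth (C : R) x y n : 0 <= C -> 0 <= h ->
  (forall v, enorm (f v) <= C * (1 + enorm v)) ->
  enorm (euler x y n)
  <= (enorm x + C * (n%:R * h) + max_psum y n) * expR (C * (n%:R * h)).
Proof.
move=> C0 h0 hf; set al := enorm x + _ + _; pose b := h * C.
have b0 : 0 <= b by rewrite mulr_ge0.
have al0 : 0 <= al by rewrite !addr_ge0 ?enorm_ge0 ?max_psum_ge0 // !mulr_ge0.
pose S m := al + b * \sum_(k < m) enorm (euler x y k).
have step m : (m <= n)%N -> enorm (euler x y m) <= S m.
  move=> mn; rewrite eulerE.
  apply: le_trans (ler_enormD _ _) _.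
  apply: le_trans (lerD (ler_enormD _ _) (enorm_psum_le y mn)) _.
  rewrite enormZ ger0_norm //.
  have hs : enorm (\sum_(k < m) f (euler x y k))
      <= C * m%:R + C * \sum_(k < m) enorm (euler x y k).
    apply: le_trans (enorm_sum_le _) _.
    apply: (@le_trans _ _ (\sum_(k < m) C * (1 + enorm (euler x y k)))).
      by apply: ler_sum => k _; apply: hf.
    by rewrite -mulr_sumr big_split /= sumr_const card_ord mulrDr.
  have mn' : m%:R <= n%:R :> R by rewrite ler_nat.
  have hhs := ler_wpM2l h0 hs.
  have hmn : (C * h) * m%:R <= (C * h) * n%:R by rewrite ler_wpM2l // mulr_ge0.
  rewrite /S /al /b; lra.
have Sle m : (m <= n)%N -> S m <= al * (1 + b) ^+ m.
  elim: m => [|m IH] mn; first by rewrite /S big_ord0 mulr0 addr0 mulr1.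
  have -> : S m.+1 = S m + b * enorm (euler x y m).
    by rewrite /S big_ord_recr /= mulrDr addrA.
  apply: (@le_trans _ _ ((1 + b) * S m)).
    by rewrite mulrDl mul1r lerD2l ler_wpM2l // step // ltnW.
  by rewrite exprS mulrCA ler_wpM2l ?addr_ge0 // IH // ltnW.
apply: le_trans (step n (leqnn n)) _; apply: le_trans (Sle n (leqnn n)) _.
rewrite ler_wpM2l // (_ : C * _ = n%:R * b); last by rewrite /b; ring.
by rewrite expRM_natl lerXn2r ?nnegrE ?addr_ge0 ?expR_ge0 // expR_ge1Dx.
Qed.

Lemma psum_continuous m : continuous (fun y => psum y m).
Proof.
apply: mx_continuous => i j.
rewrite (_ : (fun y => _) = fun y => \sum_(k < N | (k < m)%N) y i k).
  by apply: sum_continuous => k _; apply: coord_continuous.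
apply/funext => y; rewrite /psum summxE; apply: eq_bigr => k _.
by rewrite mxE.
Qed.

Lemma euler_continuous x n : continuous f -> continuous (fun y => euler x y n).
Proof.
move=> hf; elim: n => [|n IH] /=; first exact: cst_continuous.
pose F y := h *: f (euler x y n) + (psum y n.+1 - psum y n).
apply: (@mxD_continuous _ _ _ _ (fun y => euler x y n) F) => //.
apply: (@mxD_continuous _ _ _ _ (fun y => h *: f (euler x y n))
  (fun y => psum y n.+1 - psum y n)).
  under [X in continuous X]eq_fun do rewrite -mul_scalar_mx.
  apply: mulmx_continuous => y.
  exact: (@continuous_comp _ _ _ (fun y => euler x y n) f y (IH y) (hf _)).
under [X in continuous X]eq_fun do rewrite -[psum _ n]scale1r -scaleNr
  -mul_scalar_mx.
apply: (@mxD_continuous _ _ _ _ (fun y => psum y n.+1));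
  first exact: psum_continuous.
apply: mulmx_continuous; exact: psum_continuous.
Qed.

End Euler.

Section Hat.
Context {R : realType}.
Implicit Types (h s t : R) (m n : nat).

(** A second difference of [relu] in the rescaled time, equal to max(1 - |t / h - n|, 0). *)
Definition hat h n t : R :=
  let s := t / h - n%:R in relu (s + 1) - 2 * relu s + relu (s - 1).

Lemma hat_eq0 h n t : 1 <= `|t / h - n%:R| -> hat h n t = 0.
Proof.
rewrite /hat; set s := _ - _; have [s0|s0] := leP 0 s.
  by rewrite ger0_norm // => s1; rewrite !relu_ge0; lra.
by rewrite ltr0_norm // => s1; rewrite !relu_le0; lra.
Qed.

Lemma hat_left h n t : 0 <= t / h - n%:R <= 1 -> hat h n t = 1 - (t / h - n%:R).
Proof.
rewrite /hat; set s := _ - _; move=> /andP[s0 s1].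
by rewrite [relu (s - 1)]relu_le0 ?relu_ge0; lra.
Qed.

Lemma hat_right h n t : 0 <= t / h - n%:R <= 1 -> hat h n.+1 t = t / h - n%:R.
Proof.
have -> : hat h n.+1 t = let s := t / h - n%:R in relu s - 2 * relu (s - 1) +
  relu (s - 2).
  by rewrite /hat /= -natr1; congr (relu _ - 2 * relu _ + relu _); ring.
move=> /=; set s := _ - _; move=> /andP[s0 s1].
by rewrite relu_ge0 // !relu_le0; lra.
Qed.

Lemma hat_eq0_far h n m t : 0 <= t / h - n%:R <= 1 ->
  m != n -> m != n.+1 -> hat h m t = 0.
Proof.
move=> /andP[t0 t1] mn mn1; apply: hat_eq0; have [nm|mn'] := leqP n m.
  have : (n.+2 <= m)%N by lia.
  rewrite -(ler_nat R) -addn2 natrD => hm.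
  by rewrite ler0_norm; lra.
move: mn'; rewrite -(ler_nat R) -natr1 => hm.
by rewrite ger0_norm; lra.
Qed.

(** Linearity of G is replaced by its vanishing at weight 0, so that the lemma covers
    [relu_prod]. *)
Lemma sum_hat N n (G : R -> nat -> R) h t : (n < N)%N ->
  0 <= t / h - n%:R <= 1 -> (forall m, G 0 m = 0) ->
  \sum_(m < N.+1) G (hat h m t) m
  = G (1 - (t / h - n%:R)) n + G (t / h - n%:R) n.+1.
Proof.
move=> nN ht G0.
rewrite (bigD1 (Ordinal (leqW nN))) //= (bigD1 (Ordinal (nN : (n.+1 <
  N.+1)%N))) /=; last first.
  by rewrite -val_eqE /= gtn_eqF.
rewrite big1 => [|m /andP[m1 m2]].
  by rewrite addr0 hat_left // hat_right.
by rewrite (hat_eq0_far ht m1 m2).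
Qed.

End Hat.

(** * The approximating network *)

Section Approximation.
Context {R : realType} {d N : nat} (Phi : ann R d d) (h : R).
Local Notation f := (ann_realize relu Phi).
Local Notation H := (ann_hidden Phi).
Local Notation W := (d + d + ann_width Phi)%N.
Implicit Types (x : 'cV[R]_d) (y : 'M[R]_(d, N)).

(** One step adds an identity network of width 2 d to [Phi] followed by an affine map; the increment
    of y enters as a bias. Both summands have depth H, so n steps have depth n H. *)
Lemma net_euler y n : net relu (n * H) W (fun x => euler f h x y n).
Proof.
have /andP[d0 _] := ann_dim_gt0 Phi.
have /andP[dw _] := ann_dim_le_width Phi.
have dW : (0 < d <= W)%N by rewrite d0 -addnA leq_addr.
elim: n => [|n IH] /=.
  by apply: net_ext (net_linear relu 1%:M dW dW) _ => x; rewrite mul1mx.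
have dw' : (0 < d <= ann_width Phi)%N by rewrite d0.
have hf := net_comp (net_ann relu Phi)
  (net_affine relu h%:M (psum y n.+1 - psum y n) dw' dw').
rewrite addn0 in hf.
rewrite mulSnr; apply: net_ext (net_comp IH (net_add (net_id H d0) hf)) _ => x.
by rewrite /= mul_scalar_mx.
Qed.

Lemma net_hat n w : (1 + d <= w)%N -> (3 <= w)%N -> net relu 1 w
  (fun z : 'cV[R]_(1 + d) => const_mx (hat h n (usubmx z ord0 ord0)) :
    'cV[R]_1).
Proof.
move=> dw w3; have w1 : (0 < 1 <= w)%N by lia.
have hs := net_shallow relu (const_mx h^-1)
  (vec3 (1 - n%:R) (- n%:R) (- n%:R - 1))
  (mxseq 1 3 [:: [:: 1; -2; 1]]) 0 w1 w3 w1.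
apply: net_ext (net_pre (row_mx 1%:M 0) (dw : (0 < 1 + d <= w)%N) hs) _ => z.
rewrite -{1}(vsubmxK z) mul_row_col mul1mx mul0mx addr0.
apply/matrixP => i j; rewrite (ord1 i) (ord1 j) addr0.
rewrite mxE !big_ord_recl big_ord0 !mxE !big_ord1 !mxE /= /hat.
rewrite !mul1r addr0 addrA mulNr [h^-1 * _]mulrC.
congr (relu _ - 2 * relu _ + relu _); ring.
Qed.

(* On [n h, (n + 1) h] only two of the hat functions are nonzero, and
   relu_prod vanishes exactly when its first argument does. Hence the errors of
   the other terms do not add up, and the value at a time t <= n h depends only
   on the first n increments. *)
Definition interpolant k y (z : 'cV[R]_(1 + d)) : 'cV[R]_d :=
  \sum_(n < N.+1) \sum_i delta_mx i ord0 *m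
    (const_mx (relu_prod k (hat h n (usubmx z ord0 ord0))
                           (euler f h (dsubmx z) y n i ord0)) : 'cV[R]_1).

(** Hat function and Euler iterate are computed in parallel with 1 + N H hidden layers, and the
    product adds k + 2. The width factors count the nodes, the coordinates and the two parallel
    branches. *)
Lemma net_interpolant k y :
  net relu (N * H + k + 3) (N.+1 * (d * (2 * (W + 6)))) (interpolant k y).
Proof.
have /andP[d0 _] := ann_dim_gt0 Phi.
have /andP[dw _] := ann_dim_le_width Phi.
apply: net_sum => // n; apply: net_sum => // i.
have dW : (1 + d <= W + 6)%N by lia.
have W3 : (3 <= W + 6)%N by lia.
(* The hat value goes to slot 0 of a vector of length 2 and coordinate i of the iterate to slot 1,
   so that [net_add] forms the pair. *)
have hhat : net relu (1 + N * H) (W + 6) (fun z : 'cV[R]_(1 + d) =>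
    delta_mx (ord0 : 'I_2) ord0
      *m (const_mx (hat h n (usubmx z ord0 ord0)) : 'cV[R]_1)).
  refine (net_post (delta_mx ord0 ord0) _ _); first by lia.
  by apply: net_deepen; [lia | exact: net_hat].
have heul : net relu (1 + N * H) (W + 6) (fun z : 'cV[R]_(1 + d) =>
    delta_mx (lift ord0 ord0 : 'I_2) i *m euler f h (dsubmx z) y n).
  refine (net_post (delta_mx (lift ord0 ord0) i) _ _); first by lia.
  (* The iterate of index n has depth n H and is padded to the depth common to all nodes. *)
  have -> : (1 + N * H = n * H + ((N - n) * H).+1)%N.
    have : (n <= N)%N by rewrite -ltnS.
    by move=> nN; rewrite -{1}(subnKC nN) mulnDl addnS add1n.
  apply: net_deepen; first by lia.
  have he := net_weaken (leq_addr 6 W) (net_euler y n).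
  apply: net_ext (net_pre (row_mx 0 1%:M) _ he) _ => [|z]; first by lia.
  by rewrite -{1}(vsubmxK z) mul_row_col mul1mx mul0mx add0r.
have W6 : (6 <= 2 * (W + 6))%N by lia.
have hprod := net_weaken W6 (@net_relu_prod R k).
have hpair := net_add hhat heul; rewrite addnn -mul2n in hpair.
refine (net_post (delta_mx i ord0) _ _); first by lia.
have -> : (N * H + k + 3 = 1 + N * H + k.+2)%N by lia.
apply: net_ext (net_comp hpair hprod) _ => z /=.
rewrite (_ : _ + _ = vec2 (hat h n (usubmx z ord0 ord0))
                          (euler f h (dsubmx z) y n i ord0)); last first.
  apply: vec2P; rewrite vec2E !mxE big_ord1 !mxE.
    by rewrite big1 ?addr0 ?mul1r // => j _; rewrite !mxE mul0r.
  rewrite mul0r add0r (bigD1 i) //= big1 ?addr0.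
    by rewrite !mxE !eqxx mul1r.
  by move=> j /negPf ji; rewrite !mxE ji andbF mul0r.
by rewrite !vec2E.
Qed.

Lemma interpolantE k y z i : interpolant k y z i ord0 =
  \sum_(n < N.+1) relu_prod k (hat h n (usubmx z ord0 ord0))
                              (euler f h (dsubmx z) y n i ord0).
Proof.
rewrite /interpolant summxE; apply: eq_bigr => n _;
  rewrite summxE (bigD1 i) //=.
rewrite !mxE big_ord1 !mxE !eqxx mul1r big1 ?addr0 // => j /negPf ji.
by rewrite !mxE big_ord1 !mxE eq_sym ji mul0r.
Qed.

Lemma interpolant_time_space k y t x i :
  interpolant k y (time_space t x) i ord0
  = \sum_(n < N.+1) relu_prod k (hat h n t) (euler f h x y n i ord0).
Proof. by rewrite interpolantE /time_space col_mxKu col_mxKd mxE. Qed.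

Lemma interpolant_continuous k t x :
  continuous (fun y => interpolant k y (time_space t x)).
Proof.
apply: mx_continuous => i j; rewrite (ord1 j).
under [X in continuous X]eq_fun do rewrite interpolant_time_space.
apply: sum_continuous => n _ y.
apply: (@continuous_comp _ _ _ (fun y => euler f h x y n i ord0)
  (relu_prod k (hat h n t))); last exact: relu_prod_continuous.
apply: (@continuous_comp _ _ _ (fun y => euler f h x y n)
  (fun M : 'cV[R]_d => M i ord0)); last exact: coord_continuous.
by apply: euler_continuous; apply: ann_realize_continuous;
  apply: relu_continuous.
Qed.

(** Nodes m <= n see only the first n columns. For m > n the hat function vanishes at t <= n h, and
    [relu_prod0] removes the term. *)
Lemma interpolant_prefix k t x y y' n : (n <= N)%N -> 0 < h -> t <= n%:R * h ->
  (forall j : 'I_N, (j < n)%N -> col j y = col j y') ->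
  interpolant k y (time_space t x) = interpolant k y' (time_space t x).
Proof.
move=> nN h0 tn yy'; apply/matrixP => i j; rewrite (ord1 j).
rewrite !interpolant_time_space; apply: eq_bigr => m _.
have [mn|nm] := leqP m n; first by rewrite (euler_prefix f h x mn yy').
rewrite hat_eq0 ?relu_prod0 //.
have t1 : t / h <= n%:R by rewrite ler_pdivrMr.
move: nm; rewrite -(ler_nat R) -natr1 => nm.
by rewrite ler0_norm; lra.
Qed.

Lemma interpolant_piece k t x y (n : nat) : (n < N)%N ->
  0 <= t / h - n%:R <= 1 ->
  interpolant k y (time_space t x)
  = \col_i relu_prod k (1 - (t / h - n%:R)) (euler f h x y n i ord0)
  + \col_i relu_prod k (t / h - n%:R) (euler f h x y n.+1 i ord0).
Proof.
move=> nN ht; apply/matrixP => i j; rewrite (ord1 j) interpolant_time_space.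
rewrite (sum_hat (G := fun u m => relu_prod k u (euler f h x y m i ord0)) nN
  ht).
  by rewrite !mxE.
by move=> m; rewrite relu_prod0.
Qed.

End Approximation.

(** * Coordinatewise approximate product of a scalar and a vector *)

Section VectorProduct.
Context {R : realType} {d : nat}.
Implicit Types (v : 'cV[R]_d).

(** The growth is linear, at most sqrt d + g; the term g is absorbed through g <= 1 + g^2 and 1 <=
    sqrt d. *)
Lemma relu_prod_vec_norm_le k (s g : R) v : (0 < d)%N -> 0 <= s <= 1 ->
  enorm v <= g ->
  enorm (\col_i relu_prod k s (v i ord0)) <= 3 * Num.sqrt d%:R + 2 * g ^+ 2.
Proof.
move=> d0 s01 vg.
have : enorm (\col_i relu_prod k s (v i ord0)) <= 1 * Num.sqrt d%:R + 1 * enorm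
  v.
  by apply: enorm_le_coord => // i; rewrite mxE mul1r relu_prod_norm_le.
have : 1 <= Num.sqrt d%:R :> R by rewrite -{1}sqrtr1 ler_sqrt ?ler1n ?ler0n.
nra.
Qed.

(** If |v| <= 1, every coordinate has error at most e. Otherwise max(1, v_i^2) <= 1 + |v| |v_i|
    gives the bound e (sqrt d + |v|^2), and g >= 1 yields |v|^2 <= g^2 <= g^q. *)
Lemma relu_prod_vec_error k (e q s g : R) v : 0 <= s <= 1 -> 0 < e <= 1 -> 2 <=
  q ->
  (2 ^+ k)^-1 <= e -> enorm v <= g ->
  enorm (s *: v - \col_i relu_prod k s (v i ord0))
  <= e * (Num.sqrt d%:R + powR g q).
Proof.
move=> s01 /andP[e0 e1] q2 ke vg.
have err i : `|(s *: v - \col_i relu_prod k s (v i ord0)) i ord0|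
    <= e * Num.max 1 (v i ord0 ^+ 2).
  by rewrite !mxE; apply: relu_prod_error.
have hv i : v i ord0 ^+ 2 = `|v i ord0| ^+ 2 by rewrite real_normK ?num_real.
have hc := coord_le_enorm v.
rewrite mulrDr; have [v1|v1] := leP (enorm v) 1.
  apply: (@le_trans _ _ (e * Num.sqrt d%:R + 0 * enorm v)).
    apply: enorm_le_coord => // [|i]; first exact: ltW.
    rewrite mul0r addr0 (le_trans (err i)) // (max_idPl _) ?mulr1 //.
    by rewrite hv expr_le1 // (le_trans (hc i)).
  by rewrite mul0r lerD2l mulr_ge0 ?powR_ge0 // ltW.
apply: (@le_trans _ _ (e * Num.sqrt d%:R + (e * enorm v) * enorm v)).
  apply: enorm_le_coord => [||i]; [exact: ltW|rewrite mulr_ge0 ?enorm_ge0 //;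
    exact: ltW|].
  apply: le_trans (err i) _; rewrite -mulrA -{2}[e]mulr1 -mulrDr ler_pM2l //.
  have := normr_ge0 (v i ord0); have := hc i; rewrite ge_max hv => h1 h2.
  by apply/andP; split; nra.
rewrite lerD2l -mulrA ler_pM2l //.
have g1 : 1 <= g by lra.
apply: (@le_trans _ _ (powR g 2%:R)); last exact: ler_powR.
by rewrite powR_mulrn; nra.
Qed.
End VectorProduct.

(** * Parameter count *)

Lemma log2_invr_ge0 (R : realType) (e : R) : 0 < e <= 1 -> 0 <= log2 e^-1.
Proof.
move=> /andP[e0 e1]; rewrite /log2 divr_ge0 // ln_ge0 ?ler1n //.
by rewrite invf_ge1.
Qed.

(** The witness is the integer part of log2(1 / e), plus one. *)
Lemma exists_pow2_inv_le (R : realType) (e : R) : 0 < e <= 1 ->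
  exists k : nat, (2 ^+ k)^-1 <= e /\ k%:R <= log2 e^-1 + 1.
Proof.
move=> he; have L0 := log2_invr_ge0 he; move: he => /andP[e0 e1].
have /andP[h1 h2] := truncn_itv L0.
exists (Num.truncn (log2 e^-1)).+1; split; last by rewrite -natr1 lerD2r.
rewrite invf_ple ?posrE ?exprn_gt0 //.
rewrite -ler_ln ?posrE ?invr_gt0 ?exprn_gt0 // lnXn //.
rewrite -[leRHS]mulr_natl -ler_pdivrMr ?ln_gt0 ?ltr1n //; exact: ltW.
Qed.

Lemma interpolant_params_le (N d H w P k p : nat) : (0 < N)%N -> (0 < d)%N ->
  (d <= w)%N -> (w <= P)%N ->
  (p <= (N * H + k + 3).+1 * (N.+1 * (d * (2 * (d + d + w + 6))) *
        (N.+1 * (d * (2 * (d + d + w + 6)))).+1))%N ->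
  (p <= 144 * N ^ 3 * d ^ 2 * (H + k + 4) * (4 + P) ^ 2)%N.
Proof.
move=> N0 d0 dw wP hp; apply: (leq_trans hp).
set V := (N.+1 * _)%N.
(* The bounds d, w <= P give V <= 12 N d (P + 2). The remaining 24 N d in 12 N d (4 + P) covers the
   successor. *)
have V1 : (V.+1 <= 12 * (N * (d * (4 + P))))%N.
  have h1 : (d * (2 * (d + d + w + 6)) <= d * (6 * P + 12))%N.
    by rewrite leq_mul2l; apply/orP; right; lia.
  have h2 : (V <= (2 * N) * (d * (6 * P + 12)))%N by apply: leq_mul => //; lia.
  have h3 : (1 <= N * d)%N by rewrite muln_gt0 N0.
  have h4 : ((2 * N) * (d * (6 * P + 12)) + 24 * (N * d)
             = 12 * (N * (d * (4 + P))))%N by ring.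
  lia.
have hV : (V * V.+1 <= (12 * (N * (d * (4 + P)))) ^ 2)%N.
  by rewrite -mulnn; apply: leq_mul => //; apply: ltnW.
have hL : ((N * H + k + 3).+1 <= N * (H + k + 4))%N.
  have := leq_pmull (k + 4) N0; rewrite -(addnA H k 4) (mulnDr N H).
  by move: (N * H)%N (N * (k + 4))%N => u v; lia.
apply: leq_trans (leq_mul hL hV) _.
rewrite !expnMn (expnS N 2) leq_eqVlt; apply/orP; left; apply/eqP.
by move: (N ^ 2)%N (d ^ 2)%N ((4 + P) ^ 2)%N => a b c; ring.
Qed.

(* With X = 2 H + D, A = 4 + P and Q the squared bracket, Q >= A^4 >= 16 A^2,
   so (X + Q)^2 >= 4 X Q >= 64 X A^2. *)
Lemma params_bound_weaken (R : realFieldType) (N d H P k : nat) (D : R) :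
  (0 < N)%N -> (0 < d)%N -> k%:R + 4 <= D ->
  (144 * N ^ 3 * d ^ 2 * (H + k + 4) * (4 + P) ^ 2)%:R
  <= 9 / 2 * N%:R ^+ 6 * d%:R ^+ 16 *
     (2 * H%:R + D + (30 + 6 * H%:R + (4 + P%:R) ^+ 2) ^+ 2) ^+ 2.
Proof.
move=> N0 d0 kD; rewrite 4!natrM !natrX !natrD.
have H0 : 0 <= H%:R :> R by rewrite ler0n.
have P0 : 0 <= P%:R :> R by rewrite ler0n.
have k0 : 0 <= k%:R :> R by rewrite ler0n.
set A : R := 4 + P%:R; set X : R := 2 * H%:R + D.
have A4 : 4 <= A by rewrite /A; lra.
have A2 : 16 <= A ^+ 2 by nra.
have XH : H%:R + k%:R + 4 <= X by rewrite /X; lra.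
have X0 : 0 <= X by lra.
set Q := (30 + _ + _) ^+ 2.
have QA : 16 * A ^+ 2 <= Q.
  have -> : 16 * A ^+ 2 = A ^+ 2 * 16 by ring.
  apply: (@le_trans _ _ (A ^+ 2 * A ^+ 2)).
    by rewrite ler_wpM2l // sqr_ge0.
  by rewrite -expr2 /Q lerXn2r ?nnegrE; lra.
have XQ : 64 * (X * A ^+ 2) <= (X + Q) ^+ 2.
  have h1 : 0 <= (X - Q) ^+ 2 by rewrite sqr_ge0.
  have h2 : X * (16 * A ^+ 2) <= X * Q by rewrite ler_wpM2l.
  rewrite !expr2 in h1 h2 *; lra.
have N1 : 1 <= N%:R :> R by rewrite ler1n.
have d1 : 1 <= d%:R :> R by rewrite ler1n.
have NNdd : N%:R ^+ 3 * d%:R ^+ 2 <= N%:R ^+ 6 * d%:R ^+ 16 :> R.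
  by apply: ler_pM; rewrite ?exprn_ge0 ?ler0n //; apply: ler_weXn2l.
(* By [XQ] the right side is at least 9/2 * 64 = 288 times X A^2, twice what is required. *)
have key : 144 * ((H%:R + k%:R + 4) * A ^+ 2) <= 9 / 2 * (X + Q) ^+ 2.
  have : (H%:R + k%:R + 4) * A ^+ 2 <= X * A ^+ 2 by rewrite ler_wpM2r //
    sqr_ge0.
  have : 0 <= X * A ^+ 2 by rewrite mulr_ge0 // sqr_ge0.
  lra.
apply: (@le_trans _ _ (N%:R ^+ 3 * d%:R ^+ 2 * (144 * ((H%:R + k%:R + 4) * A ^+
  2)))).
  rewrite le_eqVlt; apply/orP; left; apply/eqP.
  by move: (N%:R ^+ 3) (d%:R ^+ 2) (A ^+ 2) => u v w; ring.
apply: (@le_trans _ _ (N%:R ^+ 6 * d%:R ^+ 16 * (9 / 2 * (X + Q) ^+ 2))).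
  have u0 : 0 <= N%:R ^+ 3 * d%:R ^+ 2 :> R.
    by apply: mulr_ge0; apply: exprn_ge0; apply: ler0n.
  have v0 : 0 <= (H%:R + k%:R + 4) * A ^+ 2.
    by apply: mulr_ge0; [lra | exact: sqr_ge0].
  by apply: ler_pM => //; apply: mulr_ge0.
rewrite le_eqVlt; apply/orP; left; apply/eqP.
by move: (N%:R ^+ 6) (d%:R ^+ 16) ((X + Q) ^+ 2) => u v w; ring.
Qed.

(** * Choice of the networks and verification of the six properties *)

Theorem theorem3p12 (R : realType) (N d : nat) (hN : (0 < N)%N)
  (hd : (0 < d)%N)
  (C : R) (hC : 0 <= C)
  (a : R -> R) (a_cont : continuous a) (ha : forall x : R, a x = Num.max x 0)
  (T : R) (hT : 0 < T)
  (t_ : nat -> R)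
  (ht_ : forall n : nat, (n <= N)%N -> t_ n = n%:R * T / N%:R)
  (D eps q : R) (hD1 : 1 <= D) (heps0 : 0 < eps) (heps1 : eps <= 1)
  (hq : 2 < q)
  (hD : D = (720 * q / (q - 2)) * (log2 (eps^-1) + q + 1) - 504)
  (Phi : ann R d d)
  (hPhi : forall x : 'cV[R]_d,
     enorm (ann_realize a Phi x) <= C * (1 + enorm x))
  (Y : R -> 'cV[R]_d -> 'M[R]_(d, N) -> 'cV[R]_d)
  (hY0 : forall (x : 'cV[R]_d) (y : 'M[R]_(d, N)), Y 0 x y = x)
  (hY : forall (n : 'I_N) (t : R) (x : 'cV[R]_d) (y : 'M[R]_(d, N)),
     t_ n <= t -> t <= t_ n.+1 ->
     Y t x y = Y (t_ n) x y
       + (t * N%:R / T - n%:R) *: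
         ((T / N%:R) *: ann_realize a Phi (Y (t_ n) x y) + col n y))
  (g : nat -> 'cV[R]_d -> 'M[R]_(d, N) -> R)
  (hg : forall (n : nat) (x : 'cV[R]_d) (y : 'M[R]_(d, N)), (n <= N)%N ->
     g n x y = (enorm x + C * t_ n + max_psum y n) * expR (C * t_ n)) :
  exists Psi : 'M[R]_(d, N) -> ann R (1 + d) d,
    (forall y : 'M[R]_(d, N), continuous (ann_realize a (Psi y))) /\
    (forall (n : 'I_N) (t : R) (x : 'cV[R]_d) (y : 'M[R]_(d, N)),
       t_ n <= t -> t <= t_ n.+1 ->
       enorm (Y t x y - ann_realize a (Psi y) (time_space t x))
       <= eps * (2 * Num.sqrt d%:R + powR (g n x y) q
                 + powR (g n.+1 x y) q)) /\
    (forall (n : 'I_N) (t : R) (x : 'cV[R]_d) (y : 'M[R]_(d, N)),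
       t_ n <= t -> t <= t_ n.+1 ->
       enorm (ann_realize a (Psi y) (time_space t x))
       <= 6 * Num.sqrt d%:R + 2 * (g n x y ^+ 2 + g n.+1 x y ^+ 2)) /\
    (forall y : 'M[R]_(d, N),
       (ann_params (Psi y))%:R
       <= 9 / 2 * N%:R ^+ 6 * d%:R ^+ 16 *
          (2 * (ann_hidden Phi)%:R + D
           + (30 + 6 * (ann_hidden Phi)%:R
              + (4 + (ann_params Phi)%:R) ^+ 2) ^+ 2) ^+ 2) /\
    (forall (t : R) (x : 'cV[R]_d), 0 <= t -> t <= T ->
       continuous (fun y : 'M[R]_(d, N) =>
         ann_realize a (Psi y) (time_space t x))) /\
    (forall (n : nat) (t : R) (x : 'cV[R]_d) (y z : 'M[R]_(d, N)),
       (n <= N)%N -> 0 <= t -> t <= t_ n ->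
       (forall k : 'I_N, (k < n)%N -> col k y = col k z) ->
       ann_realize a (Psi y) (time_space t x)
       = ann_realize a (Psi z) (time_space t x)).
Proof.
have a_relu : a = relu by apply/funext => x; rewrite ha.
subst a.
pose h := T / N%:R; pose H := ann_hidden Phi.
have N0 : 0 < N%:R :> R by rewrite ltr0n.
have h0 : 0 < h by rewrite divr_gt0.
have tE n : (n <= N)%N -> t_ n = n%:R * h by move=> nN; rewrite ht_ // mulrA.
have thetaE t : t * N%:R / T = t / h by rewrite /h invf_div mulrA.
have theta01 (n : 'I_N) t : t_ n <= t -> t <= t_ n.+1 ->
    0 <= t / h - n%:R <= 1.
  rewrite !tE ?(ltnW (ltn_ord n)) // => t0 t1.
  by rewrite subr_ge0 ler_pdivlMr // t0 /= lerBlDr ler_pdivrMr // addrC natr1.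
pose f := ann_realize relu Phi.
(* At the right endpoint of [t_n, t_(n+1)] the interpolation weight is 1, so [hY] becomes one Euler
   step. *)
have YE x y n : (n <= N)%N -> Y (t_ n) x y = euler f h x y n.
  elim: n => [|n IH] nN; first by rewrite tE // mul0r hY0.
  have tn1 : t_ n <= t_ n.+1.
    by rewrite !tE ?(ltnW nN) // ler_pM2r // ler_nat.
  rewrite (hY (Ordinal nN)) // IH ?(ltnW nN) //= thetaE (tE _ nN) mulfK ?gt_eqF
    //.
  by rewrite -natr1 [n%:R + 1]addrC addrK scale1r (psumS y (Ordinal nN)) /=
    [psum y n + _]addrC addrK.
have Ylin (n : 'I_N) t x y : t_ n <= t -> t <= t_ n.+1 ->
    Y t x y = (1 - (t / h - n%:R)) *: euler f h x y n
            + (t / h - n%:R) *: euler f h x y n.+1.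
  move=> t0 t1; rewrite (hY n) // YE ?(ltnW (ltn_ord n)) // thetaE /=.
  rewrite (psumS y n) [psum y n + _]addrC addrK -/f -/h [in RHS]scalerDr addrA.
  by rewrite -scalerDl subrK scale1r.
have gE x y n : (n <= N)%N -> enorm (euler f h x y n) <= g n x y.
  by move=> nN; rewrite hg // tE //; apply: euler_growth => //; apply: ltW.
have e01 : 0 < eps <= 1 by rewrite heps0.
have [k [ke kL]] := exists_pow2_inv_le e01.
have L0 := log2_invr_ge0 e01.
(* Since q / (q - 2) > 1 and q + 1 > 3, D exceeds 720 (log2(1 / eps) + 3) - 504, far above log2(1 /
   eps) + 5. *)
have kD : k%:R + 4 <= D.
  have : 720 <= 720 * q / (q - 2) by rewrite ler_pdivlMr; lra.
  rewrite hD; nra.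
have Psi_exists (y : 'M[R]_(d, N)) : exists Psi : ann R (1 + d) d,
    ann_realize relu Psi = interpolant Phi h k y /\
    (ann_params Psi <= 144 * N ^ 3 * d ^ 2 * (H + k + 4)
                       * (4 + ann_params Phi) ^ 2)%N.
  have [Psi [h1 h2 h3]] := net_interpolant Phi h k y.
  exists Psi; split; first exact/funext.
  have := ann_params_le h2; rewrite h1.
  apply: interpolant_params_le => //; last exact: ann_width_le_params.
  by have /andP[] := ann_dim_le_width Phi.
(* The networks are chosen separately for each y. Their dependence on y is still controlled, because
   the realization is the explicit [interpolant]. *)
pose Psi y := projT1 (cid (Psi_exists y)).
have PsiE y : ann_realize relu (Psi y) = interpolant Phi h k y.
  by rewrite /Psi; case: cid => ? [].
have PsiP y : (ann_params (Psi y) <= 144 * N ^ 3 * d ^ 2 * (H + k + 4)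
                       * (4 + ann_params Phi) ^ 2)%N.
  by rewrite /Psi; case: cid => ? [].
have oneB (s : R) : 0 <= s <= 1 -> 0 <= 1 - s <= 1 by lra.
exists Psi; split; [|split; [|split; [|split; [|split]]]].
- by move=> y; apply: ann_realize_continuous; apply: relu_continuous.
- move=> n t x y t0 t1; have ht := theta01 _ _ t0 t1.
  rewrite PsiE (interpolant_piece Phi k x y (ltn_ord n) ht) (Ylin n) //.
  (* Exact value and network output are both sums of two terms, at the nodes n and n + 1 with
     weights 1 - s and s; they are compared node by node. *)
  rewrite [- (\col_i _ + _)]opprD addrACA.
  apply: le_trans (ler_enormD _ _) _.
  have := relu_prod_vec_error (oneB _ ht) e01 (ltW hq) ke
    (gE x y n (ltnW (ltn_ord n))).
  have := relu_prod_vec_error ht e01 (ltW hq) ke (gE x y n.+1 (ltn_ord n)).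
  by rewrite -/f; move=> h2 h1; apply: le_trans (lerD h1 h2) _; lra.
- move=> n t x y t0 t1; have ht := theta01 _ _ t0 t1.
  rewrite PsiE (interpolant_piece Phi k x y (ltn_ord n) ht).
  apply: le_trans (ler_enormD _ _) _.
  have h1 := relu_prod_vec_norm_le k hd (oneB _ ht)
    (gE x y n (ltnW (ltn_ord n))).
  have h2 := relu_prod_vec_norm_le k hd ht (gE x y n.+1 (ltn_ord n)).
  by apply: le_trans (lerD h1 h2) _; lra.
- move=> y; apply: le_trans (params_bound_weaken H (ann_params Phi) hN hd kD).
  by rewrite ler_nat.
- move=> t x _ _; under [X in continuous X]eq_fun do rewrite PsiE.
  exact: interpolant_continuous.
- move=> n t x y z nN _ tn yz; rewrite !PsiE.
  by apply: (interpolant_prefix Phi k x nN h0 _ yz); rewrite -tE.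
Qed.
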